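(* Let $M$ be a graph-manifold whose graph $\Gamma$ has no loops, and let $m>0$. For any geometrization of $M$, with fiber lengths $(l_v)_{v\in V}$, angles $(\omega_w)_{w\in W}$ and associated edge charges $(k_w)_{w\in W}$, there exists an odd function $\Delta s:W\to\mathbb{R}\setminus\{0\}$ (that is, $\Delta s(-w)=-\Delta s(w)$) such that, with $\rho_w=m\,\Delta s(w)$, one has $1<|\rho_w|<2$ if $k_w\ne0$ and $|\rho_w|=1$ if $k_w=0$, and every field configuration $(\nabla,\xi)$ together with hermitian structure $\Lambda=(\lambda_w)_{w\in W}$ associated with the geometrization and with $\Delta s$ is critical for the action $S(\nabla,\xi)=\mathrm{YM}(\nabla)+E_\nabla(\xi)-m^2\|\xi\|^2$.
   Context: Geometrization data. $\Gamma$ is the finite graph of the graph-manifold $M$: $V$ is the set of blocks $M_v=F_v\times S^1$ (vertices), $W$ the set of oriented edges (gluing tori with orientation), with the fixed-point free orientation-reversing involution $w\mapsto -w$, initial vertex $\partial_-w$ and terminal vertex $\partial_+w=\partial_-(-w)$; multiple edges are allowed; no loops means $\partial_-w\neq\partial_+w$ for all $w$. $\partial v$ is the set of $w\in W$ with $\partial_-w=v$. $M$ determines charges $k_v\in\mathbb{Q}$ ($v\in V$) and intersection indices $b_w=b_{-w}\in\mathbb{N}$, $b_w\ge1$. A geometrization of $M$ is a metric of nonpositive curvature such that each block carries a geometric structure of type $H^2\times\mathbb{R}$ with gluing maps isometric; for the present purpose it is encoded by the fiber lengths $l_v>0$ ($v\in V$) of the blocks and the angles $0<\omega_w=\omega_{-w}<\pi$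 ($w\in W$) between the fibers of adjacent blocks, which satisfy the compatibility equation $$k_vl_v-\sum_{w\in\partial v}\frac{\cos\omega_w}{b_w}\,l_{\partial_+w}=0,\qquad v\in V.$$ Put $l_w:=l_{\partial_-w}$. The geometrization decomposes the charges over edges: for $w\in W$ the edge charge $k_w$ is the real number defined by $k_wl_w=\frac{\cos\omega_w}{b_w}l_{-w}$; thus $k_v=\sum_{w\in\partial v}k_w$, $k_wk_{-w}b_w^2=\cos^2\omega_w$, $k_wl_w^2=k_{-w}l_{-w}^2$. Fields, connections and action. Fix an odd function $\Delta s:W\to\mathbb{R}\setminus\{0\}$. In a fixed basis, a field $\xi$ is a function $W\to\mathbb{C}$, $w\mapsto\xi_w$; a hermitian structure $\Lambda$ is a function $W\to(0,\infty)$, $w\mapsto\lambda_w$; a connection $\nabla$ is given by a function $\Psi:W\to\mathbb{C}$, with $(\nabla\xi)_w=\frac{1}{\Delta s(w)}(\Psi_w\xi_{-w}-\xi_w)$. (On the edge $(w,-w)$ regarded as a two-point space with points $0=\partial_-w$, $1=\partial_+w$, $\Psi_w=1+i\phi_{01}\Delta s(w)^2$ and $\Psi_{-w}=1-i\phi_{10}\Delta s(w)^2$, where $\phi_{01},\phi_{10}$ are the coefficients of the vector potential.) The connection is $\Lambda$-hermitian if $\lambda_w\Psi_w=\lambda_{-w}\overline{\Psi_{-w}}$ for all $w$. The action is $$S(\nabla,\xi)=\sum_{w\in W}\Big[\lambda_w^2\frac{|\Psi_w\Psi_{-w}-1|^2}{\Delta s(w)^4}+\lambda_w\frac{|\Psi_w\xi_{-w}-\xi_w|^2}{\Delta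 s(w)^2}-m^2\lambda_w|\xi_w|^2\Big],$$ the three terms being $\mathrm{YM}(\nabla)$, $E_\nabla(\xi)$ and $-m^2\|\xi\|^2$. A configuration $(\nabla,\xi)$ with $\nabla$ $\Lambda$-hermitian is critical if the first variation of $S$ vanishes for all variations of $\xi$ and all variations of $\nabla$ through $\Lambda$-hermitian connections ($\Lambda$ and $\Delta s$ fixed). Configuration associated with the geometrization and $\Delta s$ (where $1<|\rho_w|<2$ if $k_w\neq0$ and $|\rho_w|=1$ if $k_w=0$, $\rho_w=m\Delta s(w)$): $\lambda_w>0$, $\xi$ and a $\Lambda$-hermitian $\nabla$ such that for all $w\in W$: (1) $\lambda_w|\xi_w|^2=|k_w|l_w^2$; (2) $\lambda_w(|\rho_w|-1)=|k_w|$ (so $\lambda_w>0$ is arbitrary if $k_w=0$); (3) $\psi_w:=\lambda_w|\Psi_w|=|\cos\omega_w|/b_w$; (4) if $k_w\ne0$: $\arg\xi_{-w}-\arg\xi_w+\gamma_w$ is an odd multiple of $\pi$, where $\gamma_w=\arg\Psi_w$; and $\arg\xi_w=\arg\xi_{w'}$ whenever $w,w'\in\partial v$ and $\xi_w,\xi_{w'}\neq0$. *)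

(* Defs.v *)
From HB Require Import structures.
From mathcomp Require Import all_boot all_order all_algebra.
From mathcomp Require Import all_classical all_reals all_analysis.
From mathcomp.real_closed Require Export complex.

Set Implicit Arguments.
Unset Strict Implicit.
Unset Printing Implicit Defensive.

Import Order.TTheory GRing.Theory Num.Theory.
Import numFieldNormedType.Exports.

Local Open Scope ring_scope.

(* The geometrization data of a graph-manifold: its graph (multiple edges and
   loops allowed), with charges on the vertices and intersection indices on the
   edges.  The terminal vertex is derived from the initial one. *)
Record graphManifold := GraphManifold {
  vertex : finType;
  oedge : finType;
  rev : oedge -> oedge;
  rev_involutive : involutive rev;
  rev_fixfree : forall w, rev w != w;
  src : oedge -> vertex;
  charge : vertex -> rat;
  bidx : oedge -> nat;
  bidx_ge1 : forall w, (1 <= bidx w)%N;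
  bidx_rev : forall w, bidx (rev w) = bidx w
}.

Definition tgt (M : graphManifold) (w : oedge M) : vertex M := src (rev w).

Definition no_loops (M : graphManifold) : Prop :=
  forall w : oedge M, src w != tgt w.

Record geometrization (R : realType) (M : graphManifold) := Geometrization {
  flen : vertex M -> R;
  angle : oedge M -> R;
  flen_gt0 : forall v, 0 < flen v;
  angle_itv : forall w, 0 < angle w < pi;
  angle_rev : forall w, angle (rev w) = angle w;
  compatibility : forall v,
    ratr (charge v) * flen v
      - \sum_(w : oedge M | src w == v)
          cos (angle w) / (bidx w)%:R * flen (tgt w) = 0
}.

Section Geometrization.
Variables (R : realType) (M : graphManifold) (G : geometrization R M).

Definition elen (w : oedge M) : R := flen G (src w).

(* The solution k_w of k_w l_w = (cos omega_w / b_w) l_{-w}. *)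
Definition edge_charge (w : oedge M) : R :=
  cos (angle G w) / (bidx w)%:R * elen (rev w) / elen w.

End Geometrization.

Section ComplexArgument.
Variable R : realType.

(* The real-valued modulus; [`|z|] on [R[i]] takes its values in [R[i]]. *)
Definition modc (z : R[i]) : R := Normc.normc z.

(* Principal argument, in ]-pi, pi]; only meaningful for z <> 0. *)
Definition argc (z : R[i]) : R :=
  if 0 <= complex.Im z then acos (complex.Re z / modc z)
  else - acos (complex.Re z / modc z).

Definition odd_multiple_pi (x : R) : Prop :=
  exists n : int, x = (2 * n + 1)%:~R * pi.

End ComplexArgument.

Section FieldTheory.
Variables (R : realType) (M : graphManifold).
Local Notation W := (oedge M).

(* A connection is represented by its function Psi, a hermitian structure by
   its (positive) function lambda. *)
Implicit Types (ds lam : W -> R) (Psi xi : W -> R[i]) (m : R).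

Definition odd_edge_function ds : Prop := forall w, ds (rev w) = - ds w.

Definition hermitian lam Psi : Prop :=
  forall w, ((lam w)%:C * Psi w = (lam (rev w))%:C * (Psi (rev w))^*)%C.

Definition YM ds lam Psi : R :=
  \sum_(w : W)
    lam w ^+ 2 * (modc (Psi w * Psi (rev w) - 1) ^+ 2 / ds w ^+ 4).

Definition energy ds lam Psi xi : R :=
  \sum_(w : W) lam w * (modc (Psi w * xi (rev w) - xi w) ^+ 2 / ds w ^+ 2).

Definition field_normsq lam xi : R := \sum_(w : W) lam w * modc (xi w) ^+ 2.

Definition action m ds lam Psi xi : R :=
  YM ds lam Psi + energy ds lam Psi xi - m ^+ 2 * field_normsq lam xi.

Definition derivable_at0 (f : R -> W -> R[i]) : Prop :=
  forall w, derivable (fun t => complex.Re (f t w)) 0 1 /\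
            derivable (fun t => complex.Im (f t w)) 0 1.

(* The first variation is taken along all one-parameter families of
   configurations through (Psi, xi), differentiable at 0 and consisting of
   hermitian connections; xi and Psi may vary simultaneously. *)
Definition critical m ds lam Psi xi : Prop :=
  hermitian lam Psi /\
  forall (Psi_ xi_ : R -> W -> R[i]),
    Psi_ 0 =1 Psi -> xi_ 0 =1 xi ->
    derivable_at0 Psi_ -> derivable_at0 xi_ ->
    (forall t, hermitian lam (Psi_ t)) ->
    is_derive (0 : R) (1 : R) (fun t : R => action m ds lam (Psi_ t) (xi_ t)) 0.

Record associated (G : geometrization R M) m ds lam Psi xi : Prop := Associated {
  assoc_lam_gt0 : forall w, 0 < lam w;
  assoc_hermitian : hermitian lam Psi;
  assoc_field : forall w,
    lam w * modc (xi w) ^+ 2 = `|edge_charge G w| * elen G w ^+ 2;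
  assoc_lam : forall w, lam w * (`|m * ds w| - 1) = `|edge_charge G w|;
  assoc_connection : forall w,
    lam w * modc (Psi w) = `|cos (angle G w)| / (bidx w)%:R;
  assoc_phase_edge : forall w, edge_charge G w != 0 ->
    odd_multiple_pi (argc (xi (rev w)) - argc (xi w) + argc (Psi w));
  assoc_phase_vertex : forall w w', src w = src w' ->
    xi w != 0 -> xi w' != 0 -> argc (xi w) = argc (xi w')
}.

End FieldTheory.

(* Main.v *)
Require Import Defs.
From HB Require Import structures.
From mathcomp Require Import all_boot all_order all_algebra.
From mathcomp Require Import all_classical all_reals all_analysis.
From mathcomp Require Import ring lra.

Import Order.TTheory GRing.Theory Num.Theory.
Import numFieldNormedType.Exports.

Local Open Scope ring_scope.

(* The hermitian condition expresses [Psi (rev w)] through [Psi w], so the action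
   splits into independent contributions of the edges [{w, rev w}], each a
   polynomial in [Psi w], [xi w], [xi (rev w)].  Write [|rho_w| = 1 + r] with
   [l = l_w], [l' = l_{-w}], [c = |cos omega_w| / b_w].  For an associated
   configuration with [k_w <> 0] one gets [|xi_w| = sqrt r * l],
   [|xi_{-w}| = sqrt r * l'], [|Psi_w| = r * l / l'], and the phase condition makes
   all terms of each Euler-Lagrange equation parallel.  The two field equations
   then hold for every [r], and the connection equation becomes
     m^2 c (l^4 + l'^4) (1 - r) = r (1 + r)^2 (l l')^3,
   which has a solution [r] in [0, 1[ by the intermediate value theorem, with
   [r = 0] exactly when [c = 0], i.e. [k_w = 0].  In that case the fields and the
   connection vanish on the edge and criticality is trivial. *)

(** * Modulus and argument of complex numbers *)

Lemma ratio_norm2_itv (R : realType) (x y : R) :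
  -1 <= x / Num.sqrt (x ^+ 2 + y ^+ 2) <= 1.
Proof.
rewrite -ler_norml normrM normfV (ger0_norm (sqrtr_ge0 _)).
have [->|N0] := eqVneq (Num.sqrt (x ^+ 2 + y ^+ 2)) 0.
  by rewrite invr0 mulr0.
rewrite ler_pdivrMr ?lt_def ?N0 ?sqrtr_ge0 // mul1r -sqrtr_sqr.
by rewrite ler_wsqrtr // lerDl sqr_ge0.
Qed.

Lemma modc_sqr (R : realType) (z : R[i]) :
  modc z ^+ 2 = complex.Re z ^+ 2 + complex.Im z ^+ 2.
Proof. by case: z => x y; rewrite sqr_sqrtr // addr_ge0 ?sqr_ge0. Qed.

Lemma modc_ge0 (R : realType) (z : R[i]) : 0 <= modc z.
Proof. by case: z => x y; apply: sqrtr_ge0. Qed.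

(** The polar form also holds at [z = 0], where the modulus kills whatever value [argc] takes; hence
    no case distinction is needed for vanishing fields. *)
Lemma argcP {R : realType} (z : R[i]) :
  complex.Re z = modc z * cos (argc z) /\ complex.Im z = modc z * sin (argc z).
Proof.
case: z => x y; rewrite /argc /modc /=.
set n := Num.sqrt _; have n2 : n ^+ 2 = x ^+ 2 + y ^+ 2.
  by rewrite sqr_sqrtr // addr_ge0 ?sqr_ge0.
have n0 : 0 <= n := sqrtr_ge0 _.
have [nz|nz] := eqVneq n 0.
  move: n2; rewrite nz expr0n /= => /esym/eqP.
  by rewrite paddr_eq0 ?sqr_ge0 // !sqrf_eq0 => /andP[/eqP-> /eqP->]; rewrite !mul0r.
have xn := @ratio_norm2_itv R x y; rewrite -/n in xn.
have cE : cos (acos (x / n)) = x / n by rewrite acosK // in_itv.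
have sE : sin (acos (x / n)) = `|y| / n.
  rewrite sin_acos // (_ : 1 - _ = (y / n) ^+ 2).
    by rewrite sqrtr_sqr normrM normfV (ger0_norm n0).
  by rewrite -[1](divff (expf_neq0 2 nz)) {1}n2; field.
case: ifP => y0; rewrite ?cosN ?sinN cE sE ?mulrN [n * (_ / n)]mulrC !divfK //.
  by rewrite mulrC divfK // ger0_norm.
by rewrite mulrC divfK // ltr0_norm ?opprK // ltNge y0.
Qed.

(** For [a = n * pi], induction on [n] gives [sin a = 0], hence [cos a ^+ 2 = 1]. The double-angle
    formulas then settle [2 * a], and the extra [pi] flips the signs. *)
Lemma odd_multiple_pi_cos_sin (R : realType) (x : R) :
  odd_multiple_pi x -> cos x = -1 /\ sin x = 0.
Proof.
case=> n ->; set a : R := n%:~R * pi.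
have -> : (2 * n + 1)%:~R * pi = a *+ 2 + pi :> R.
  by rewrite /a rmorphD rmorphM /= mulrDl mul1r -mulrA mulr_natl.
have sa : sin a = 0.
  rewrite /a; case: n {a} => n; rewrite ?NegzE ?mulrNz ?mulNr ?sinN -?pmulrn mulr_natl.
    elim: n => [|n IH]; first by rewrite mulr0n sin0.
    by rewrite mulrS addrC sinDpi IH oppr0.
  elim: n => [|n IH]; first by rewrite mulr1n sinpi oppr0.
  by rewrite mulrS addrC sinDpi opprK; apply/eqP; rewrite -oppr_eq0 IH.
have := cos2Dsin2 a; rewrite sa expr0n addr0 => ca.
by rewrite cosDpi sinDpi cos_mulr2n sin_mulr2n sa ca mulr0 mul0rn oppr0; split; ring.
Qed.

(** * The balance equation *)

Lemma balance_solvable (R : realType) (a b : R) : 0 <= a -> 0 < b ->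
  exists2 r : R, 0 <= r < 1 & a * (1 - r) = r * (1 + r) ^+ 2 * b.
Proof.
move=> a0 b0.
pose p : {poly R} := (a%:P * (1 - 'X) - b%:P * ('X * (1 + 'X) ^+ 2)).
have pE r : p.[r] = a * (1 - r) - b * (r * (1 + r) ^+ 2).
  by rewrite /p !hornerE.
have pc : {within `[0, 1], continuous (horner p)}%classic.
  by apply: continuous_subspaceT => z; apply: continuous_horner.
have p0 : Num.min p.[0] p.[1] <= 0 <= Num.max p.[0] p.[1].
  (* The end values are [p.[0] = a >= 0] and [p.[1] = - 4 * b < 0]; the latter also excludes the
     root [r = 1] below. *)
  rewrite !pE ge_min le_max; apply/andP; split; apply/orP; [right|left]; nra.
have [r] := IVT ler01 pc p0.
rewrite in_itv /= pE => /andP[r0 r1] /eqP; rewrite subr_eq0 => /eqP E.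
exists r; last by rewrite E; ring.
rewrite r0 lt_neqAle r1 andbT; apply/eqP => r1E; move: E; rewrite r1E; nra.
Qed.

(** * The density of the action on one edge *)

(* [x + iy] and [x' + iy'] are the fields at the two ends of an edge, [u + iv]
   and [u' + iv'] the connection coefficients from the far end, [q] the hermitian
   weight at the near end. *)
Definition end_density {R : realType} (m d q u v u' v' x y x' y' : R) : R :=
  q ^+ 2 * (((u * u' - v * v' - 1) ^+ 2 + (u * v' + v * u') ^+ 2) / d ^+ 4)
  + q * (((u * x' - v * y' - x) ^+ 2 + (u * y' + v * x' - y) ^+ 2) / d ^+ 2)
  - m ^+ 2 * (q * (x ^+ 2 + y ^+ 2)).

(** Sum of both end densities once the far coefficient is replaced by [k] times the conjugate of
    [u + iv]; [D] stands for [d ^- 2]. Squares of the variables are written as products, so that the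
    sum and product rules suffice for differentiation. *)
Definition edge_density {R : realType} (m D q q' u v x y x' y' : R) : R :=
  let k := q / q' in let p := u * u + v * v in
  (q ^+ 2 + q' ^+ 2) * (D * D) * ((k * p - 1) * (k * p - 1))
  + D * (q * p * (x' * x' + y' * y') + q * k * p * (x * x + y * y)
         - 4 * q * (u * (x * x' + y * y') + v * (x' * y - y' * x)))
  + (D - m ^+ 2) * (q * (x * x + y * y) + q' * (x' * x' + y' * y')).

(* The left-hand sides are half the partial derivatives of [edge_density]. *)
Definition edge_stationary {R : realType} (m D q q' u v x y x' y' : R) : Prop :=
  let k := q / q' in let p := u * u + v * v in
  let N := x * x + y * y in let N' := x' * x' + y' * y' in
  [/\ 2 * (q ^+ 2 + q' ^+ 2) * (D * D) * k * (k * p - 1) * u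
        + D * (q * (N' + k * N) * u - 2 * q * (x * x' + y * y')) = 0 /\
      2 * (q ^+ 2 + q' ^+ 2) * (D * D) * k * (k * p - 1) * v
        + D * (q * (N' + k * N) * v - 2 * q * (x' * y - y' * x)) = 0,
      D * (q * k * p * x - 2 * q * (u * x' - v * y'))
        + (D - m ^+ 2) * q * x = 0,
      D * (q * k * p * y - 2 * q * (u * y' + v * x'))
        + (D - m ^+ 2) * q * y = 0,
      D * (q * p * x' - 2 * q * (u * x + v * y))
        + (D - m ^+ 2) * q' * x' = 0 &
      D * (q * p * y' - 2 * q * (u * y - v * x))
        + (D - m ^+ 2) * q' * y' = 0].

(** The product of the two connection coefficients is the real number [k * p], [q' * k = q], and
    only even powers of [d] occur, so the opposite sign at the far end is harmless. *)
Lemma end_densityD (R : realType) (m d q q' u v x y x' y' : R) :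
  d != 0 -> q != 0 -> q' != 0 ->
  let k := q / q' in
  end_density m d q u v (k * u) (- (k * v)) x y x' y'
  + end_density m (- d) q' (k * u) (- (k * v)) u v x' y' x y
  = edge_density m (d ^- 2) q q' u v x y x' y'.
Proof.
move=> d0 q0 q'0 k; rewrite /end_density /edge_density /k; field.
by rewrite d0 q'0.
Qed.

(** * First variation of the edge density *)

Lemma is_derive_cst_fun (R : realType) (a x : R) :
  is_derive x (1 : R) (fun=> a) 0.
Proof. exact: is_derive_cst. Qed.

Lemma is_deriveD_fun (R : realType) (f g : R -> R) (x df dg : R) :
  is_derive x (1 : R) f df -> is_derive x (1 : R) g dg ->
  is_derive x (1 : R) (fun t => f t + g t) (df + dg).
Proof. exact: is_deriveD. Qed.

Lemma is_deriveN_fun (R : realType) (f : R -> R) (x df : R) :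
  is_derive x (1 : R) f df -> is_derive x (1 : R) (fun t => - f t) (- df).
Proof. exact: is_deriveN. Qed.

Lemma is_deriveM_fun {R : realType} {f g : R -> R} {x df dg : R} :
  is_derive x (1 : R) f df -> is_derive x (1 : R) g dg ->
  is_derive x (1 : R) (fun t => f t * g t) (f x * dg + g x * df).
Proof. exact: is_deriveM. Qed.

Lemma is_derive_edge_density (R : realType) (m D q q' : R)
    (u v x y x' y' : R -> R) :
  derivable u (0 : R) (1 : R) -> derivable v (0 : R) (1 : R) ->
  derivable x (0 : R) (1 : R) -> derivable y (0 : R) (1 : R) ->
  derivable x' (0 : R) (1 : R) -> derivable y' (0 : R) (1 : R) ->
  edge_stationary m D q q' (u 0) (v 0) (x 0) (y 0) (x' 0) (y' 0) ->
  is_derive (0 : R) (1 : R)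
    (fun t => edge_density m D q q' (u t) (v t) (x t) (y t) (x' t) (y' t)) 0.
Proof.
move=> /derivableP du /derivableP dv /derivableP dx /derivableP dy.
move=> /derivableP dx' /derivableP dy'; rewrite /edge_stationary.
set k := q / q'; set p := u 0 * u 0 + v 0 * v 0.
set N := x 0 * x 0 + y 0 * y 0; set N' := x' 0 * x' 0 + y' 0 * y' 0.
move=> [[eu ev] ex ey ex' ey'].
rewrite /edge_density /=; apply: is_derive_eq.
  repeat first [exact: du | exact: dv | exact: dx | exact: dy | exact: dx'
    | exact: dy' | exact: is_derive_cst_fun | apply: is_deriveD_fun
    | apply: is_deriveN_fun | apply: is_deriveM_fun ].
move: ('D_1 u 0) ('D_1 v 0) ('D_1 x 0) ('D_1 y 0) ('D_1 x' 0) ('D_1 y' 0).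
move=> {du dv dx dy dx' dy'} du dv dx dy dx' dy'.
(* The chain rule pairs the gradient with the velocity: each stationarity expression multiplies the
   derivative of its own variable. *)
transitivity (2 * (
  (2 * (q ^+ 2 + q' ^+ 2) * (D * D) * k * (k * p - 1) * u 0
    + D * (q * (N' + k * N) * u 0 - 2 * q * (x 0 * x' 0 + y 0 * y' 0))) * du +
  (2 * (q ^+ 2 + q' ^+ 2) * (D * D) * k * (k * p - 1) * v 0
    + D * (q * (N' + k * N) * v 0 - 2 * q * (x' 0 * y 0 - y' 0 * x 0))) * dv +
  (D * (q * k * p * x 0 - 2 * q * (u 0 * x' 0 - v 0 * y' 0))
    + (D - m ^+ 2) * q * x 0) * dx +
  (D * (q * k * p * y 0 - 2 * q * (u 0 * y' 0 + v 0 * x' 0))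
    + (D - m ^+ 2) * q * y 0) * dy +
  (D * (q * p * x' 0 - 2 * q * (u 0 * x 0 + v 0 * y 0))
    + (D - m ^+ 2) * q' * x' 0) * dx' +
  (D * (q * p * y' 0 - 2 * q * (u 0 * y 0 - v 0 * x 0))
    + (D - m ^+ 2) * q' * y' 0) * dy')).
  by rewrite /k /p /N /N' /GRing.scale /=; ring.
by rewrite eu ev ex ey ex' ey' !mul0r !addr0 mulr0.
Qed.

(** * The Euler-Lagrange equations on one edge *)

(** In polar form, with [s ^+ 2] in the role of [r], every equation is a real scalar times one
    common phase. For the fields the scalar vanishes because [D * (1 + s ^+ 2) ^+ 2 = m ^+ 2]; for
    the connection it is a multiple of the balance defect. *)
Lemma edge_euler_lagrange (R : realType) (m l l' q q' c s th th' g : R)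
    (P := s ^+ 2 * l / l') (X := s * l) (X' := s * l') :
  0 < l -> 0 < l' -> 0 < s -> 0 < q ->
  odd_multiple_pi (th' - th + g) ->
  q * s ^+ 2 * l = c * l' -> q' * l' ^+ 2 = q * l ^+ 2 ->
  m ^+ 2 * c * (l ^+ 4 + l' ^+ 4) * (1 - s ^+ 2)
    = s ^+ 2 * (1 + s ^+ 2) ^+ 2 * (l * l') ^+ 3 ->
  edge_stationary m ((m / (1 + s ^+ 2)) ^+ 2) q q'
    (P * cos g) (P * sin g) (X * cos th) (X * sin th)
    (X' * cos th') (X' * sin th').
Proof.
move=> l0 l'0 s0 q0 /odd_multiple_pi_cos_sin; set a := th' - th + g.
move=> [ca sa] hc hq' bal.
rewrite /edge_stationary; set D := (m / _) ^+ 2.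
set u := P * cos g; set v := P * sin g; set x := X * cos th.
set y := X * sin th; set x' := X' * cos th'; set y' := X' * sin th'.
set k := q / q'; set p := u * u + v * v.
set N := x * x + y * y; set N' := x' * x' + y' * y'.
have [l_n0 l'_n0 s_n0 q_n0] : [/\ l != 0, l' != 0, s != 0 & q != 0].
  by rewrite !gt_eqF.
have s1_n0 : 1 + s ^+ 2 != 0 by rewrite gt_eqF // ltr_pwDl // sqr_ge0.
have cosa z : cos (z + a) = - cos z by rewrite cosD ca sa; ring.
have sina z : sin (z + a) = - sin z by rewrite sinD ca sa; ring.
(* [E1] to [E6] are the real and imaginary parts of [e^{i(g+th')} = -e^{i th}],
   [e^{i(th-g)} = -e^{i th'}] and [e^{i(th-th')} = -e^{i g}]. *)
have E1 : cos g * cos th' - sin g * sin th' = - cos th.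
  by rewrite -cosD -cosa; congr cos; rewrite /a; ring.
have E2 : cos g * sin th' + sin g * cos th' = - sin th.
  by rewrite addrC -sinD -sina; congr sin; rewrite /a; ring.
have E3 : cos g * cos th + sin g * sin th = - cos th'.
  by rewrite -cosB -[in RHS]cosN -cosa; congr cos; rewrite /a; ring.
have E4 : cos g * sin th - sin g * cos th = - sin th'.
  transitivity (sin (- (- th' + a))); last by rewrite sinN sina sinN; ring.
  by rewrite (_ : - (_ + a) = th - g) ?sinB; [ring | rewrite /a; ring].
have E5 : cos th * cos th' + sin th * sin th' = - cos g.
  by rewrite -cosB -[in RHS]cosN -cosa -cosN; congr cos; rewrite /a; ring.
have E6 : cos th' * sin th - sin th' * cos th = - sin g.
  transitivity (sin (- (- g + a))); last by rewrite sinN sina sinN; ring.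
  by rewrite (_ : - (_ + a) = th - th') ?sinB; [ring | rewrite /a; ring].
have q'E : q' = q * l ^+ 2 / l' ^+ 2.
  by rewrite -hq' mulfK // expf_neq0.
have kE : k = l' ^+ 2 / l ^+ 2.
  by rewrite /k q'E; field; rewrite q_n0 l_n0 l'_n0.
have pE : p = P ^+ 2 by rewrite -[RHS]mulr1 -(cos2Dsin2 g) /p /u /v; ring.
have NE : N = X ^+ 2 by rewrite -[RHS]mulr1 -(cos2Dsin2 th) /N /x /y; ring.
have N'E : N' = X' ^+ 2 by rewrite -[RHS]mulr1 -(cos2Dsin2 th') /N' /x' /y'; ring.
have F1 : u * x' - v * y' = - (P * X') * cos th.
  by rewrite mulNr -mulrN -E1 /u /v /x' /y'; ring.
have F2 : u * y' + v * x' = - (P * X') * sin th.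
  by rewrite mulNr -mulrN -E2 /u /v /x' /y'; ring.
have F3 : u * x + v * y = - (P * X) * cos th'.
  by rewrite mulNr -mulrN -E3 /u /v /x /y; ring.
have F4 : u * y - v * x = - (P * X) * sin th'.
  by rewrite mulNr -mulrN -E4 /u /v /x /y; ring.
have F5 : x * x' + y * y' = - (X * X') * cos g.
  by rewrite mulNr -mulrN -E5 /x /y /x' /y'; ring.
have F6 : x' * y - y' * x = - (X * X') * sin g.
  by rewrite mulNr -mulrN -E6 /x /y /x' /y'; ring.
have qE : q = c * l' / (s ^+ 2 * l).
  by rewrite -hc; field; rewrite l_n0 s_n0.
(* Taking [e] to be [cos g] or [sin g] gives the two components of the connection equation. *)
have vertical e : 2 * (q ^+ 2 + q' ^+ 2) * (D * D) * k * (k * p - 1) * (P * e)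
      + D * (q * (N' + k * N) * (P * e) - 2 * q * (- (X * X') * e)) = 0.
  have -> : 2 * (q ^+ 2 + q' ^+ 2) * (D * D) * k * (k * p - 1) * (P * e)
      + D * (q * (N' + k * N) * (P * e) - 2 * q * (- (X * X') * e))
    = - (2 * q * D * e / (1 + s ^+ 2) / (l * l') ^+ 2)
      * (m ^+ 2 * c * (l ^+ 4 + l' ^+ 4) * (1 - s ^+ 2)
         - s ^+ 2 * (1 + s ^+ 2) ^+ 2 * (l * l') ^+ 3).
    rewrite kE pE NE N'E q'E qE /P /X /X' /D; field.
    by rewrite l_n0 l'_n0 s_n0 s1_n0.
  by rewrite bal subrr mulr0.
split; rewrite ?F1 ?F2 ?F3 ?F4 ?F5 ?F6; try split; try exact: vertical;
  rewrite ?kE ?pE ?NE ?N'E ?q'E /x /y /x' /y' /P /X /X' /D; field;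
  by rewrite ?l_n0 ?l'_n0 ?s1_n0.
Qed.

Lemma edge_stationary0 (R : realType) (m D q q' : R) :
  edge_stationary m D q q' 0 0 0 0 0 0.
Proof. by rewrite /edge_stationary; repeat split; ring. Qed.

(** * Splitting the action over edges *)

Lemma is_derive_sum_fun (R : realType) (I : finType) (h : I -> R -> R) (x : R) :
  (forall i, is_derive x (1 : R) (h i) 0) ->
  is_derive x (1 : R) (fun t => \sum_i h i t) 0.
Proof.
move=> dh; rewrite (_ : (fun t => _) = \sum_i h i); last first.
  by apply/funext => t; rewrite fct_sumE.
elim/big_ind: _ => [|f g df dg|i _]; [exact: is_derive_cst| |exact: dh].
by apply: is_derive_eq; rewrite addr0.
Qed.

(** Pairing [w] with its reverse counts each edge twice; the factor [2^-1] compensates, and no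
    orientation has to be chosen. *)
Lemma sum_oedge_rev (R : realType) (M : graphManifold) (f : oedge M -> R) :
  \sum_w f w = 2^-1 * \sum_w (f w + f (Defs.rev w)).
Proof.
rewrite big_split /=.
have <- : \sum_w f w = \sum_w f (Defs.rev w).
  exact: reindex_inj (inv_inj (@rev_involutive M)).
by field.
Qed.

Lemma hermitian_rev (R : realType) (M : graphManifold) (lam : oedge M -> R)
    (Psi : oedge M -> R[i]) (w : oedge M) :
  (forall w, 0 < lam w) -> Defs.hermitian lam Psi ->
  complex.Re (Psi (Defs.rev w)) = lam w / lam (Defs.rev w) * complex.Re (Psi w) /\
  complex.Im (Psi (Defs.rev w)) = - (lam w / lam (Defs.rev w) * complex.Im (Psi w)).
Proof.
move=> lam0 /(_ w); have := lam0 (Defs.rev w).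
move: (lam w) (lam (Defs.rev w)) (Psi w) (Psi (Defs.rev w)) => q q' [u v] [u' v'] q'0 /=.
have q'n0 : q' != 0 by rewrite gt_eqF.
rewrite /complex.real_complex_def; simpc => -[e1 e2].
by split; apply: (mulfI q'n0); [rewrite -e1 | rewrite -[LHS]opprK -e2]; field.
Qed.

Lemma action_edge_density (R : realType) (M : graphManifold) (m : R)
    (ds lam : oedge M -> R) (Psi xi : oedge M -> R[i]) :
  (forall w, ds w != 0) -> odd_edge_function ds -> (forall w, 0 < lam w) ->
  Defs.hermitian lam Psi ->
  action m ds lam Psi xi =
  2^-1 * \sum_w edge_density m (ds w ^- 2) (lam w) (lam (Defs.rev w))
    (complex.Re (Psi w)) (complex.Im (Psi w))
    (complex.Re (xi w)) (complex.Im (xi w))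
    (complex.Re (xi (Defs.rev w))) (complex.Im (xi (Defs.rev w))).
Proof.
move=> ds0 dsN lam0 herm.
pose e w := end_density m (ds w) (lam w) (complex.Re (Psi w))
  (complex.Im (Psi w)) (complex.Re (Psi (Defs.rev w))) (complex.Im (Psi (Defs.rev w)))
  (complex.Re (xi w)) (complex.Im (xi w))
  (complex.Re (xi (Defs.rev w))) (complex.Im (xi (Defs.rev w))).
have -> : action m ds lam Psi xi = \sum_w e w.
  rewrite /action /YM /energy /field_normsq mulr_sumr -big_split -sumrB /=.
  apply: eq_bigr => w _; rewrite /e /end_density !modc_sqr.
  move: (Psi w) (Psi (Defs.rev w)) (xi w) (xi (Defs.rev w)) => [u v] [u' v'] [x y] [x' y'].
  by rewrite /= oppr0 addr0.
rewrite sum_oedge_rev; congr (_ * _); apply: eq_bigr => w _.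
have [hu hv] := @hermitian_rev R M lam Psi w lam0 herm.
by rewrite /e rev_involutive hu hv dsN end_densityD // gt_eqF.
Qed.

Lemma modc_eq0 (R : realType) (z : R[i]) : modc z = 0 -> z = 0.
Proof. exact: Normc.eq0_normc. Qed.

(** * Criticality of associated configurations *)

Lemma associated_edge_stationary (R : realType) (M : graphManifold) (m : R)
    (G : geometrization R M) (ds lam : oedge M -> R) (Psi xi : oedge M -> R[i])
    (w : oedge M) (r : R)
    (l := elen G w) (l' := elen G (Defs.rev w))
    (c := `|cos (angle G w)| / (bidx w)%:R) :
  0 < m -> odd_edge_function ds -> 0 <= r -> `|m * ds w| = 1 + r ->
  m ^+ 2 * c * (l ^+ 4 + l' ^+ 4) * (1 - r) = r * (1 + r) ^+ 2 * (l * l') ^+ 3 ->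
  associated G m ds lam Psi xi ->
  edge_stationary m (ds w ^- 2) (lam w) (lam (Defs.rev w))
    (complex.Re (Psi w)) (complex.Im (Psi w))
    (complex.Re (xi w)) (complex.Im (xi w))
    (complex.Re (xi (Defs.rev w))) (complex.Im (xi (Defs.rev w))).
Proof.
move=> m0 dsN r0 dsr bal [lam0 _ hxi hlam hpsi hedge _].
have l0 : 0 < l := flen_gt0 G _.
have l'0 : 0 < l' := flen_gt0 G _.
have b0 : 0 < (bidx w)%:R :> R by rewrite ltr0n bidx_ge1.
have ek : `|edge_charge G w| = c * l' / l.
  rewrite /edge_charge !normrM !normfV (ger0_norm (ltW l0)) (ger0_norm (ltW l'0)).
  by rewrite (ger0_norm (ltW b0)).
have ek' : `|edge_charge G (Defs.rev w)| = c * l / l'.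
  rewrite /edge_charge !normrM !normfV rev_involutive angle_rev bidx_rev.
  by rewrite (ger0_norm (ltW l0)) (ger0_norm (ltW l'0)) (ger0_norm (ltW b0)).
have dsr' : `|m * ds (Defs.rev w)| = 1 + r by rewrite dsN mulrN normrN.
have dsr2 : (1 + r) ^+ 2 = m ^+ 2 * ds w ^+ 2.
  by rewrite -dsr real_normK ?num_real // exprMn.
have := hlam w; have := hlam (Defs.rev w).
have := hxi w; have := hxi (Defs.rev w); have := hpsi w.
rewrite {}dsr {}dsr' ek ek' -/c -/l -/l' ![1 + r]addrC !addrK.
set q := lam w; set q' := lam _ => eP eX' eX eq' eq.
clearbody c l l'.
have [q0 q'0] : 0 < q /\ 0 < q' by split; apply: lam0.
(* If [c = 0], conditions (1) and (3), with positive weights, force both fields and the connection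
   to vanish on the edge. *)
have [c0|c_n0] := eqVneq c 0.
  rewrite c0 !mul0r in eP eX eX'.
  have z0 a (z : R[i]) : 0 < a -> a * modc z ^+ 2 = 0 -> z = 0.
    move=> a0 /eqP; rewrite mulf_eq0 sqrf_eq0 gt_eqF //= => /eqP; exact: modc_eq0.
  rewrite (z0 q (xi w)) // (z0 q' (xi (Defs.rev w))) //.
  rewrite (z0 q (Psi w)) //; first exact: edge_stationary0.
  by rewrite expr2 mulrA eP mul0r.
have ek_n0 : edge_charge G w != 0.
  by rewrite -normr_eq0 ek !mulf_eq0 invr_eq0 (negbTE c_n0) !gt_eqF.
have r_gt0 : 0 < r.
  rewrite lt_def r0 andbT; apply: contra_neq ek_n0 => r_eq0.
  by apply/eqP; rewrite -normr_eq0 ek -eq r_eq0 mulr0.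
(* The field moduli are [sqrt r] times the lengths; writing [r = s ^+ 2] keeps all later identities
   rational. *)
pose s := Num.sqrt r.
have s0 : 0 < s by rewrite sqrtr_gt0.
have s2 : s ^+ 2 = r by rewrite sqr_sqrtr.
have [q_n0 q'_n0 l_n0 l'_n0] : [/\ q != 0, q' != 0, l != 0 & l' != 0].
  by rewrite !gt_eqF.
have sq_inj (a b : R) : 0 <= a -> 0 <= b -> a ^+ 2 = b ^+ 2 -> a = b.
  by move=> a0 b00 /eqP; rewrite eqrXn2 // => /eqP.
have X : modc (xi w) = s * l.
  apply: sq_inj; rewrite ?modc_ge0 ?mulr_ge0 ?(ltW s0) ?(ltW l0) //.
  by apply: (mulfI q_n0); rewrite eX -eq -s2; ring.
have X' : modc (xi (Defs.rev w)) = s * l'.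
  apply: sq_inj; rewrite ?modc_ge0 ?mulr_ge0 ?(ltW s0) ?(ltW l'0) //.
  by apply: (mulfI q'_n0); rewrite eX' -eq' -s2; ring.
have hc : q * s ^+ 2 * l = c * l' by rewrite s2 eq; field.
have P : modc (Psi w) = s ^+ 2 * l / l'.
  apply: (mulfI q_n0); rewrite eP; transitivity (q * s ^+ 2 * l / l'); last by ring.
  by rewrite hc mulfK.
(* After multiplication by [r], both sides equal [c * l * l']. *)
have hq' : q' * l' ^+ 2 = q * l ^+ 2.
  apply: (@mulIf _ r); first by rewrite gt_eqF.
  transitivity (q' * r * l' ^+ 2); first by ring.
  transitivity (q * r * l ^+ 2); last by ring.
  by rewrite eq' eq; field; rewrite l_n0 l'_n0.
have -> : ds w ^- 2 = (m / (1 + s ^+ 2)) ^+ 2.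
  by rewrite expr_div_n s2 dsr2 [in RHS]invfM mulVKf // sqrf_eq0 gt_eqF.
have [-> ->] := argcP (Psi w); have [-> ->] := argcP (xi w).
have [-> ->] := argcP (xi (Defs.rev w)); rewrite X X' P.
by apply: (@edge_euler_lagrange R m l l' q q' c) => //; [exact: hedge | rewrite s2].
Qed.

Lemma critical_associated (R : realType) (M : graphManifold) (m : R)
    (G : geometrization R M) (ds lam : oedge M -> R) (Psi xi : oedge M -> R[i])
    (r : oedge M -> R) :
  0 < m -> (forall w, ds w != 0) -> odd_edge_function ds ->
  (forall w, 0 <= r w) -> (forall w, `|m * ds w| = 1 + r w) ->
  (forall w, let l := elen G w in let l' := elen G (Defs.rev w) in
    m ^+ 2 * (`|cos (angle G w)| / (bidx w)%:R) * (l ^+ 4 + l' ^+ 4) * (1 - r w)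
    = r w * (1 + r w) ^+ 2 * (l * l') ^+ 3) ->
  associated G m ds lam Psi xi -> critical m ds lam Psi xi.
Proof.
move=> m0 ds0 dsN r0 dsr bal ass; have lam0 := assoc_lam_gt0 ass.
split; first exact: assoc_hermitian ass.
move=> Psi_ xi_ Psi_0 xi_0 dPsi dxi herm.
pose e w t := edge_density m (ds w ^- 2) (lam w) (lam (Defs.rev w))
    (complex.Re (Psi_ t w)) (complex.Im (Psi_ t w))
    (complex.Re (xi_ t w)) (complex.Im (xi_ t w))
    (complex.Re (xi_ t (Defs.rev w))) (complex.Im (xi_ t (Defs.rev w))).
(* The whole family is hermitian, so the edge splitting holds at every [t] and may be
   differentiated. *)
have -> : (fun t => action m ds lam (Psi_ t) (xi_ t))
    = (fun t => 2^-1 * \sum_w e w t).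
  by apply/funext => t; rewrite action_edge_density.
have de : is_derive (0 : R) (1 : R) (fun t => \sum_w e w t) 0.
  apply: is_derive_sum_fun => w.
  have [dx dy] := dxi w; have [dx' dy'] := dxi (Defs.rev w).
  have [du dv] := dPsi w.
  apply: (is_derive_edge_density _ _ _ _ _ _ _ _ _ _ _ du dv dx dy dx' dy').
  rewrite Psi_0 !xi_0.
  exact: (@associated_edge_stationary R M m G ds lam Psi xi w (r w)).
have := is_deriveM_fun (is_derive_cst_fun R 2^-1 0) de.
by rewrite !mulr0 addr0.
Qed.

(** * Construction of the function on oriented edges *)

Theorem theorem6p1 (R : realType) (M : graphManifold) (m : R)
    (hM : no_loops M) (hm : 0 < m) (G : geometrization R M) :
  exists ds : oedge M -> R,
    [/\ forall w, ds w != 0,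
        odd_edge_function ds,
        forall w, edge_charge G w != 0 -> 1 < `|m * ds w| < 2,
        forall w, edge_charge G w = 0 -> `|m * ds w| = 1
      & forall (lam : oedge M -> R) (Psi xi : oedge M -> R[i]),
          associated G m ds lam Psi xi -> critical m ds lam Psi xi].
Proof.
(* The root is chosen as a function of the coefficients, not of the edge: they are symmetric under
   reversal, so [r] is too. The value 0 is a default outside the sign conditions. *)
have balanced (z : R * R) : exists r, 0 <= z.1 -> 0 < z.2 ->
    0 <= r < 1 /\ z.1 * (1 - r) = r * (1 + r) ^+ 2 * z.2.
  have [a0|] := leP 0 z.1; last by exists 0.
  have [|b0] := leP z.2 0; first by exists 0.
  by have [r] := @balance_solvable R z.1 z.2 a0 b0; exists r.
have [rad radP] := choice balanced.
pose l w := elen G w; pose l' w := elen G (Defs.rev w).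
pose c w := `|cos (angle G w)| / (bidx w)%:R.
pose z w := (m ^+ 2 * c w * (l w ^+ 4 + l' w ^+ 4), (l w * l' w) ^+ 3).
pose r w := rad (z w).
have l0 w : 0 < l w := flen_gt0 G _.
have l'0 w : 0 < l' w := flen_gt0 G _.
have c0 w : 0 <= c w by rewrite divr_ge0 ?ler0n.
have [r01 bal] : (forall w, 0 <= r w < 1) /\ forall w,
    (z w).1 * (1 - r w) = r w * (1 + r w) ^+ 2 * (z w).2.
  by apply/all_and2 => w; apply: radP; rewrite /= ?exprn_gt0 ?mulr_gt0 //
    mulr_ge0 ?mulr_ge0 ?addr_ge0 ?exprn_ge0 // ltW.
have r0 w : 0 <= r w by case/andP: (r01 w).
have r1 w : 0 < 1 + r w by rewrite ltr_pwDl.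
have r_rev w : r (Defs.rev w) = r w.
  rewrite /r /z /c /l /l' rev_involutive angle_rev bidx_rev; congr rad.
  by rewrite [elen G w * _]mulrC [elen G w ^+ 4 + _]addrC.
(* Up to positive factors the balance equation reads [c * (1 - r) = r], so [c] and [r] vanish
   together. *)
have k_r w : (edge_charge G w == 0) = (r w == 0).
  have -> : (edge_charge G w == 0) = (c w == 0).
    rewrite /edge_charge /c !mulf_eq0 !invr_eq0 normr_eq0.
    by rewrite !(gt_eqF (l0 _)) !orbF.
  have B0 : 0 < (1 + r w) ^+ 2 * (l w * l' w) ^+ 3.
    by rewrite mulr_gt0 ?exprn_gt0 ?mulr_gt0.
  have A0 : 0 < m ^+ 2 * (l w ^+ 4 + l' w ^+ 4).
    by rewrite mulr_gt0 ?addr_gt0 ?exprn_gt0.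
  have E : m ^+ 2 * (l w ^+ 4 + l' w ^+ 4) * (c w * (1 - r w))
      = r w * ((1 + r w) ^+ 2 * (l w * l' w) ^+ 3).
    by rewrite [RHS]mulrA -(bal w) /=; ring.
  apply/eqP/eqP => [cE|rE]; move/eqP: E.
    by rewrite cE mul0r mulr0 eq_sym mulf_eq0 (gt_eqF B0) orbF => /eqP.
  by rewrite rE subr0 mulr1 mul0r mulf_eq0 (gt_eqF A0) => /eqP.
(* Comparing ranks in the enumeration orients each edge; since reversal has no fixed point the ranks
   differ, so [sg] is odd. *)
pose sg (w : oedge M) : R := if (enum_rank w < enum_rank (Defs.rev w))%N then 1 else -1.
pose ds w := sg w * ((1 + r w) / m).
have ds_norm w : `|m * ds w| = 1 + r w.
  rewrite /ds mulrCA normrM [m * _]mulrC divfK ?gt_eqF // (gtr0_norm (r1 w)).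
  by rewrite /sg; case: ifP; rewrite ?normrN normr1 mul1r.
have ds0 w : ds w != 0.
  apply: contraTneq (r1 w) => dsE.
  by rewrite -ds_norm dsE mulr0 normr0 ltxx.
have dsN : odd_edge_function ds.
  move=> w; rewrite /ds r_rev -mulNr; congr (_ * _).
  rewrite /sg rev_involutive; case: ltngtP => //; first by rewrite opprK.
  move/ord_inj/enum_rank_inj => E.
  by have := rev_fixfree w; rewrite E eqxx.
exists ds; split=> // [w|w|lam Psi xi].
- rewrite k_r ds_norm => rN; have /andP[_ rlt] := r01 w.
  have : 0 < r w by rewrite lt_def rN r0.
  by move=> rgt; apply/andP; split; lra.
- by move/eqP; rewrite k_r ds_norm => /eqP->; rewrite addr0.
exact: (@critical_associated R M m G ds lam Psi xi r).
Qed.
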